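(* Let $\mathcal{A}$ be a finite or countable alphabet, $\mathcal{M}$ a countable set of probability measures on $\mathcal{A}^\infty$, $w:\mathcal{M}\to(0,1]$ a prior with $\sum_\nu w_\nu=1$, $\xi$ the Bayes mixture, $\mu\in\mathcal{M}$ and $\delta\in(0,1)$, with $\hat d_t:=c_t/(w_\mu\delta)$. Then: (1) $\mathbb{E}_\mu\sum_{t=1}^\infty\hat d_t\le\frac{\mathrm{Ent}(w)}{\delta w_\mu^2}$; (2) with $\mu$-probability at least $1-\delta$, $\sum_{t=1}^\infty\hat d_t\le\frac{\mathrm{Ent}(w)}{\delta^2w_\mu^2}$.
   Context: $\mathcal{A}^\infty$ carries the $\sigma$-algebra generated by cylinders $\Gamma_x=\{x\omega\}$; for a measure $\rho$, $\rho(x):=\rho(\Gamma_x)$, $\rho(y|x):=\rho(xy)/\rho(x)$. Bayes mixture $\xi(A):=\sum_\nu w_\nu\nu(A)$; posterior $w_\nu(x):=w_\nu\nu(x)/\xi(x)$; entropy $\mathrm{Ent}(w):=-\sum_\nu w_\nu\ln w_\nu$ (natural logs). For a finite string $x$, $d_x(\nu,\xi):=\sum_a\nu(a|x)\ln\frac{\nu(a|x)}{\xi(a|x)}$, and for $\omega\in\mathcal{A}^\infty$, $c_t(\omega):=\sum_{\nu\in\mathcal{M}}w_\nu(\omega_{<t})d_{\omega_{<t}}(\nu,\xi)$ with $\omega_{<t}=\omega_1\cdots\omega_{t-1}$. *)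

(* Defs.v *)
From HB Require Import structures.
From mathcomp Require Import all_boot all_order all_algebra.
From mathcomp Require Import all_classical all_reals all_analysis.
Set Implicit Arguments. Unset Strict Implicit. Unset Printing Implicit Defensive.
Import Order.TTheory GRing.Theory Num.Theory.
Local Open Scope classical_set_scope.
Local Open Scope ring_scope.

Section Defs.
Variable A : pointedType.

Definition cyl (x : seq A) : set (nat -> A) := [set om | mkseq om (size x) = x].

Definition seqspace := g_sigma_algebraType (range cyl).

(* omega_{<t} = omega_1 ... omega_{t-1} (with 0-based indexing: first t-1 symbols) *)
Definition prefix (om : nat -> A) (t : nat) : seq A := mkseq om t.-1.

Variable R : realType.

Definition pr (P : probability seqspace R) (x : seq A) : R := fine (P (cyl x)).

Variable I : choiceType.
Variables (nu : I -> probability seqspace R) (w : I -> R).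

Definition xsum {J : choiceType} (f : J -> \bar R) : \bar R :=
  (\esum_(j in [set: J]) maxe (f j) 0%E - \esum_(j in [set: J]) maxe (- f j) 0%E)%E.

Definition xi (x : seq A) : R := fine (\esum_(i in [set: I]) (w i * pr (nu i) x)%:E)%E.

Definition nu_cond (i : I) (x : seq A) (a : A) : R := pr (nu i) (rcons x a) / pr (nu i) x.
Definition xi_cond (x : seq A) (a : A) : R := xi (rcons x a) / xi x.

Definition post (i : I) (x : seq A) : R := w i * pr (nu i) x / xi x.

Definition dKL (i : I) (x : seq A) : \bar R :=
  xsum (fun a : A => (nu_cond i x a * ln (nu_cond i x a / xi_cond x a))%:E).

Definition ct (t : nat) (om : nat -> A) : \bar R :=
  xsum (fun i : I => ((post i (prefix om t))%:E * dKL i (prefix om t))%E).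

Definition Ent : \bar R := xsum (fun i : I => (- (w i * ln (w i)))%:E).

End Defs.

(* Main.v *)
Require Import Defs.
From HB Require Import structures.
From mathcomp Require Import all_boot all_order all_algebra ring lra.
From mathcomp Require Import all_classical all_reals all_analysis.
From mathcomp Require Import measurable_realfun.
Import Order.TTheory GRing.Theory Num.Theory.
Set Implicit Arguments. Unset Strict Implicit. Unset Printing Implicit Defensive.
Local Open Scope classical_set_scope.
Local Open Scope ring_scope.

(* Put L_i(x) := nu_i(x) ln (xi(x) / (w_i nu_i(x))), which is nonnegative since
   w_i nu_i <= xi. The chain rule for the logarithm reads
     nu_i(x) d_x(nu_i, xi) + sum_a L_i(xa) = L_i(x),
   so the expected one-step divergences of nu_i from xi telescope and sum up to
   at most L_i(empty word) = - ln w_i. Since xi(x) times the value of c at x is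
   sum_i w_i nu_i(x) d_x(nu_i, xi), averaging over i bounds the xi-expectation
   of sum_t c_t by Ent(w), and w_mu mu <= xi transfers the bound to mu at the
   price of a factor 1 / w_mu. The second claim is Markov's inequality. *)

(** * Unordered sums of nonnegative extended reals and their integrals *)

Section esum_lemmas.
Local Open Scope ereal_scope.
Context {R : realType}.

Lemma le_esumZl (T : choiceType) (S : set T) (c : R) (a : T -> \bar R) :
  (0 <= c)%R -> (forall x, 0 <= a x) ->
  \esum_(x in S) (c%:E * a x) <= c%:E * \esum_(x in S) a x.
Proof.
move=> c0 a0; apply: ge_ereal_sup => _ [X [finX XS] <-].
rewrite -ge0_mule_fsumr//.
rewrite lee_wpmul2l//.
by apply: ereal_sup_ubound; exists X.
Qed.

Lemma esumZl (T : choiceType) (S : set T) (c : R) (a : T -> \bar R) :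
  (0 <= c)%R -> (forall x, 0 <= a x) ->
  \esum_(x in S) (c%:E * a x) = c%:E * \esum_(x in S) a x.
Proof.
move=> c0 a0; apply/eqP; rewrite eq_le le_esumZl//=.
have [->|cn0] := eqVneq c 0%R; first by rewrite mul0e esum_ge0// => x _; rewrite mul0e.
have cgt0 : (0 < c)%R by rewrite lt_neqAle eq_sym cn0.
(* The reverse inequality is [le_esumZl] again, for the scalar [c^-1] and the family [c * a]. *)
rewrite -lee_pdivlMl// -[leLHS](_ : \esum_(x in S) (c^-1%:E * (c%:E * a x)) = _); last first.
  by apply: eq_esum => x _; rewrite muleA -EFinM mulVf// mul1e.
by apply: le_esumZl; rewrite ?invr_ge0// => x; rewrite mule_ge0 ?lee_fin.
Qed.

(** Both iterated sums are sums over a product, and swapping the coordinates matches the two. *)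
Lemma exchange_esum (T1 T2 : choiceType) (S1 : set T1) (S2 : set T2)
    (a : T1 -> T2 -> \bar R) : (forall x y, 0 <= a x y) ->
  \esum_(x in S1) \esum_(y in S2) a x y = \esum_(y in S2) \esum_(x in S1) a x y.
Proof.
move=> a0; rewrite !esum_esum//.
rewrite (reindex_esum (S2 `*`` (fun=> S1)) _ (fun z => (z.2, z.1)))//.
split => [z []//|[x y] [x' y'] _ _ /= [-> ->]//|[x y] [/= Sx Sy]].
by exists (y, x).
Qed.

Lemma esum_singleton (T : choiceType) (S : set T) (x : T) (a : T -> \bar R) :
  S x -> 0 <= a x -> (forall y, S y -> y <> x -> a y = 0) ->
  \esum_(y in S) a y = a x.
Proof.
move=> Sx ax0 a0; rewrite (esumID [set x]).
  rewrite [X in _ + X]esum1; last by move=> y [Sy yx]; exact: a0.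
  by rewrite adde0 setI1 mem_set// esum_set1.
by move=> y Sy; have [->//|/eqP yx] := eqVneq y x; rewrite a0.
Qed.

(** The enumeration is chosen before the family [a], so a single one serves every point of a
    measurable space at once. This reduces measurability and termwise integration of unordered sums
    to the same facts for series. *)
Lemma countable_esum_nneseries (T : choiceType) (x0 : T) (S : set T) :
  countable S -> exists (P : pred nat) (e : nat -> T),
  forall a : T -> \bar R, (forall x, S x -> 0 <= a x) ->
  \esum_(x in S) a x = \sum_(n <oo | n \in P) a (e n).
Proof.
move=> /countable_injP[f finj].
have fbij := injpinv_bij (fun=> x0) finj.
have [fS _ _] := fbij.
exists (fun n => n \in f @` S), ('pinv_(fun=> x0) S f) => a a0.
rewrite nneseries_esum; last first.
  by move=> n; rewrite !inE => /fS; exact: a0.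
apply: reindex_esum; rewrite (_ : [set _ | _] = f @` S)//.
by apply/seteqP; split => n /=; rewrite inE.
Qed.

Context d (Om : measurableType d).

Lemma ge0_emeasurable_esum (T : choiceType) (x0 : T) (S : set T)
    (f : T -> Om -> \bar R) :
  countable S -> (forall x, measurable_fun setT (f x)) ->
  (forall x om, 0 <= f x om) ->
  measurable_fun setT (fun om => \esum_(x in S) f x om).
Proof.
move=> /(countable_esum_nneseries x0)[P [e PE]] mf f0.
rewrite (_ : (fun _ => _) = fun om => \sum_(n <oo | n \in P) f (e n) om).
  exact: ge0_emeasurable_sum.
by apply/funext => om; rewrite PE.
Qed.

Lemma ge0_integral_esum (mu : {measure set Om -> \bar R})
    (T : choiceType) (x0 : T) (S : set T) (f : T -> Om -> \bar R) :
  countable S -> (forall x, measurable_fun setT (f x)) ->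
  (forall x om, 0 <= f x om) ->
  \int[mu]_om (\esum_(x in S) f x om) = \esum_(x in S) \int[mu]_om f x om.
Proof.
move=> /(countable_esum_nneseries x0)[P [e PE]] mf f0.
rewrite PE; last by move=> x _; exact: integral_ge0.
under eq_integral do rewrite PE// eseries_mkcond.
rewrite integral_nneseries//; last 2 first.
- by move=> n; case: (n \in P).
- by move=> n om _; case: ifP.
rewrite [RHS]eseries_mkcond; apply: eq_eseriesr => n _.
by case: (n \in P) => //; rewrite integral0.
Qed.

End esum_lemmas.

(** A word is coded by the number that [choice.pickle] gives to its letterwise image in [nat]. *)
Lemma countable_seq (T : Type) : countable [set: T] -> countable [set: seq T].
Proof.
move=> /countable_injP[f finj]; apply/countable_injP.
exists (fun s => choice.pickle (map f s)) => s t _ _ /(pcan_inj choice.pickleK).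
by apply: inj_map => x y; apply: finj; rewrite inE.
Qed.

(** * Words, cylinders, and functions of a finite prefix *)

Section words.
Variables (A : pointedType) (R : realType).

Definition words (n : nat) : set (seq A) := [set x | size x = n].

Lemma measurable_cyl (x : seq A) : measurable (cyl x : set (seqspace A)).
Proof. by apply: sub_sigma_algebra; exists x. Qed.

Lemma cyl_nil : cyl (@nil A) = setT.
Proof. by apply/seteqP; split. Qed.

Lemma cyl_rcons (x : seq A) (a : A) (om : nat -> A) :
  cyl (rcons x a) om <-> cyl x om /\ om (size x) = a.
Proof.
rewrite /cyl /= size_rcons mkseqS; split => [/rcons_inj[]//|[-> ->]//].
Qed.

Local Open Scope ereal_scope.

Lemma esum_words_rcons n (f : seq A -> \bar R) : (forall x, 0 <= f x) ->
  \esum_(x in words n.+1) f x =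
  \esum_(x in words n) \esum_(a in [set: A]) f (rcons x a).
Proof.
move=> f0; rewrite esum_esum//.
rewrite (reindex_esum (words n `*`` (fun=> [set: A])) _ (fun z => rcons z.1 z.2))//.
split.
- by move=> [x a] [/= xn _]; rewrite /words /= size_rcons xn.
- by move=> [x a] [y b] _ _ /= /rcons_inj[-> ->].
- move=> x; case/lastP: x => [//|x a]; rewrite /words /= size_rcons => -[xn].
  by exists (x, a).
Qed.

(** Exactly one word of length [n] has [om] in its cylinder. A function of the prefix thus becomes a
    countable combination of indicators of cylinders, which gives both its measurability and its
    integral. *)
Lemma prefix_indicE n (F : seq A -> \bar R) (om : nat -> A) :
  (forall x, 0 <= F x) ->
  F (mkseq om n) = \esum_(x in words n) F x * (\1_(cyl x) om)%:E.
Proof.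
move=> F0; rewrite (@esum_singleton _ _ _ (mkseq om n)).
- by rewrite indicE mem_set ?mule1// /cyl /= size_mkseq.
- by rewrite /words /= size_mkseq.
- by rewrite mule_ge0// lee_fin.
- move=> y yn ym; rewrite indicE memNset ?mule0// /cyl /=.
  by rewrite yn => /esym.
Qed.

Lemma measurable_indic_cyl (x : seq A) :
  measurable_fun [set: seqspace A] (fun om => (\1_(cyl x) om : R)%:E).
Proof.
by apply/measurable_EFinP; apply: measurable_indic; exact: measurable_cyl.
Qed.

Lemma pr_ge0 (P : probability (seqspace A) R) x : (0 <= pr P x)%R.
Proof. exact/fine_ge0/measure_ge0. Qed.

Lemma pr_EFin (P : probability (seqspace A) R) x : (pr P x)%:E = P (cyl x).
Proof. by rewrite /pr fineK// fin_num_measure//; exact: measurable_cyl. Qed.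

Lemma pr_nil (P : probability (seqspace A) R) : pr P [::] = 1%R.
Proof. by apply: EFin_inj; rewrite pr_EFin cyl_nil probability_setT. Qed.

Hypothesis cA : countable [set: A].

Lemma countable_words n : countable (words n).
Proof. exact: sub_countable (subset_card_le (@subsetT _ _)) (countable_seq cA). Qed.

Lemma measurable_prefix n (F : seq A -> \bar R) : (forall x, 0 <= F x) ->
  measurable_fun [set: seqspace A] (fun om => F (mkseq om n)).
Proof.
move=> F0; rewrite (_ : (fun _ => _) = fun om : seqspace A =>
    \esum_(x in words n) F x * (\1_(cyl x) om)%:E); last first.
  by apply/funext => om; exact: prefix_indicE.
apply: (ge0_emeasurable_esum [::] (countable_words n)).
  move=> x; apply: measurable_funeM; exact: measurable_indic_cyl.
by move=> x om; rewrite mule_ge0// lee_fin.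
Qed.

Lemma integral_prefix (P : probability (seqspace A) R) n (F : seq A -> \bar R) :
  (forall x, 0 <= F x) ->
  \int[P]_om F (mkseq om n) = \esum_(x in words n) F x * (pr P x)%:E.
Proof.
move=> F0; rewrite (eq_integral (fun om : seqspace A =>
    \esum_(x in words n) F x * (\1_(cyl x) om)%:E)); last first.
  by move=> om _; exact: prefix_indicE.
rewrite (ge0_integral_esum P [::] (countable_words n)).
- apply: eq_esum => x _; rewrite ge0_integralZl//.
  + rewrite integral_indic ?setIT//; last exact: measurable_cyl.
    by rewrite pr_EFin.
  + exact: measurable_indic_cyl.
- move=> x; apply: measurable_funeM; exact: measurable_indic_cyl.
- by move=> x om; rewrite mule_ge0// lee_fin.
Qed.

(** The cylinders of the one-letter extensions of [x] partition [cyl x]; the identity is the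
    integral of the corresponding identity between indicators. *)
Lemma esum_pr_rcons (P : probability (seqspace A) R) x :
  \esum_(a in [set: A]) (pr P (rcons x a))%:E = (pr P x)%:E.
Proof.
rewrite pr_EFin -[in RHS](setIT (cyl x)) -integral_indic//; last exact: measurable_cyl.
transitivity (\esum_(a in [set: A]) \int[P]_om (\1_(cyl (rcons x a)) om)%:E).
  apply: eq_esum => a _; rewrite pr_EFin integral_indic ?setIT//.
  exact: measurable_cyl.
rewrite -(ge0_integral_esum P point cA); last 2 first.
- by move=> a; exact: measurable_indic_cyl.
- by move=> a om; rewrite lee_fin.
apply: eq_integral => om _; have [omx|omx] := pselect (cyl x om).
  rewrite (@esum_singleton _ _ _ (om (size x)))//.
  - by rewrite !indicE !mem_set//; apply/cyl_rcons.
  - by move=> a _ ne; rewrite indicE memNset// => /cyl_rcons[_ /esym].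
rewrite indicE memNset// esum1// => a _.
by rewrite indicE memNset// => /cyl_rcons[].
Qed.

End words.

Lemma ln_le_subr1 (R : realType) (x : R) : 0 < x -> ln x <= x - 1.
Proof. by move=> x0; rewrite -{1}(subrKC 1 x) le_ln1Dx//; lra. Qed.

Lemma ge0_xsumE (R : realType) (J : choiceType) (f : J -> \bar R) :
  (forall j, 0 <= f j)%E -> xsum f = \esum_(j in [set: J]) f j.
Proof.
move=> f0; rewrite /xsum [X in (_ - X)%E]esum1 ?sube0.
  by apply: eq_esum => j _; apply/max_idPl.
by move=> j _; apply/max_idPr; rewrite leeNl oppe0.
Qed.

(** * The Bayes mixture, the potential, and the divergence *)

Section mixture.
Variables (R : realType) (A : pointedType) (I : choiceType).
Variables (nu : I -> probability (seqspace A) R) (w : I -> R).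
Hypothesis cA : countable [set: A].
Hypothesis w01 : forall i, 0 < w i <= 1.
Hypothesis w1 : (\esum_(i in [set: I]) (w i)%:E = 1)%E.

Let w_gt0 i : 0 < w i. Proof. by have /andP[] := w01 i. Qed.
Let w_ge0 i : 0 <= w i. Proof. exact/ltW. Qed.

Lemma wpr_ge0 i x : 0 <= w i * pr (nu i) x.
Proof. by rewrite mulr_ge0// pr_ge0. Qed.

(** The sum is at most the total prior mass 1, so [fine] in [xi] loses nothing. *)
Lemma xi_EFin x :
  (xi nu w x)%:E = (\esum_(i in [set: I]) (w i * pr (nu i) x)%:E)%E.
Proof.
rewrite /xi fineK// ge0_fin_numE; last first.
  by apply: esum_ge0 => i _; rewrite lee_fin wpr_ge0.
apply: (@le_lt_trans _ _ 1%E); last by rewrite ltry.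
rewrite -w1; apply: le_esum => i _; rewrite lee_fin ler_piMr//.
by rewrite -lee_fin pr_EFin probability_le1//; exact: measurable_cyl.
Qed.

Lemma le_xi i x : w i * pr (nu i) x <= xi nu w x.
Proof.
rewrite -lee_fin xi_EFin; apply: esum_ge; exists [set i].
  by split.
by rewrite fsbig_set1.
Qed.

Lemma xi_ge0 x : 0 <= xi nu w x.
Proof. by apply/fine_ge0/esum_ge0 => i _; rewrite lee_fin wpr_ge0. Qed.

Lemma xi_gt0 i x : 0 < pr (nu i) x -> 0 < xi nu w x.
Proof. by move=> p0; apply: lt_le_trans (le_xi i x); rewrite mulr_gt0. Qed.

Lemma xi_nil : xi nu w [::] = 1.
Proof.
apply: EFin_inj; rewrite xi_EFin -w1.
by apply: eq_esum => i _; rewrite pr_nil mulr1.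
Qed.

(** The mixture inherits consistency under one-letter extension from its components, by exchanging
    the sums over letters and over [I]. *)
Lemma esum_xi_rcons x :
  (\esum_(a in [set: A]) (xi nu w (rcons x a))%:E = (xi nu w x)%:E)%E.
Proof.
under eq_esum do rewrite xi_EFin.
rewrite exchange_esum; last by move=> a i; rewrite lee_fin wpr_ge0.
rewrite xi_EFin; apply: eq_esum => i _.
under eq_esum do rewrite EFinM.
rewrite esumZl ?esum_pr_rcons//.
by move=> a; rewrite lee_fin pr_ge0.
Qed.

Lemma pr_rcons_eq0 i x a : pr (nu i) x = 0 -> pr (nu i) (rcons x a) = 0.
Proof.
move=> p0; apply/eqP; rewrite eq_le pr_ge0 andbT -[leRHS]p0.
rewrite -lee_fin -[leRHS](esum_pr_rcons cA).
by apply: esum_ge; exists [set a]; [split|rewrite fsbig_set1].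
Qed.

(* [- ln (post i x)] weighted by [nu_i(x)]; summed over the words of length [n]
   it is the part of the entropy of [w] not yet spent after [n] symbols. *)
Definition potential i x : R :=
  pr (nu i) x * ln (xi nu w x / (w i * pr (nu i) x)).

Lemma potential_eq0 i x : pr (nu i) x = 0 -> potential i x = 0.
Proof. by rewrite /potential => ->; rewrite mul0r. Qed.

Lemma potential_ge0 i x : 0 <= potential i x.
Proof.
have [/potential_eq0->//|p0] := eqVneq (pr (nu i) x) 0.
have p_gt0 : 0 < pr (nu i) x by rewrite lt_neqAle eq_sym p0 pr_ge0.
rewrite mulr_ge0 ?pr_ge0// ln_ge0// ler_pdivlMr ?mulr_gt0// mul1r.
exact: le_xi.
Qed.

Lemma potential_nil i : potential i [::] = - ln (w i).
Proof. by rewrite /potential pr_nil xi_nil mulr1 mul1r div1r lnV ?posrE. Qed.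

(** Division by zero yields zero, so every conditional probability after a null word is zero, and so
    is every summand. *)
Lemma dKL_eq0 i x : pr (nu i) x = 0 -> dKL nu w i x = 0%E.
Proof.
move=> p0; rewrite /dKL ge0_xsumE.
  by apply: esum1 => a _; rewrite /nu_cond p0 invr0 mulr0 mul0r.
by move=> a; rewrite /nu_cond p0 invr0 mulr0 mul0r.
Qed.

(** * The chain rule at a word of positive probability *)

Section positive_word.
Variables (i : I) (x : seq A).
Hypothesis p_gt0 : 0 < pr (nu i) x.

Let x_gt0 := xi_gt0 p_gt0.

Lemma potential_rcons a : pr (nu i) (rcons x a) != 0 ->
  potential i (rcons x a) = pr (nu i) (rcons x a) *
    (ln (xi nu w x / (w i * pr (nu i) x)) +
     ln (xi_cond nu w x a / nu_cond nu i x a)).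
Proof.
move=> pa0; have pa_gt0 : 0 < pr (nu i) (rcons x a).
  by rewrite lt_neqAle eq_sym pa0 pr_ge0.
have xa_gt0 := xi_gt0 pa_gt0.
rewrite /potential /xi_cond /nu_cond -lnM ?posrE ?divr_gt0 ?mulr_gt0 ?invr_gt0//.
congr (_ * ln _); field.
by rewrite !gt_eqF.
Qed.

(** This is [ln q <= q - 1] for [q] the ratio of the conditional probabilities of [xi] and [nu i],
    multiplied by [pr (nu i) (rcons x a)]. The subtracted 1 is moved to the left, so that each side
    is a sum of nonnegative terms. *)
Lemma potential_rcons_le a :
  potential i (rcons x a) + pr (nu i) (rcons x a) <=
  ln (xi nu w x / (w i * pr (nu i) x)) * pr (nu i) (rcons x a) +
  pr (nu i) x / xi nu w x * xi nu w (rcons x a).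
Proof.
have [pa0|pa0] := eqVneq (pr (nu i) (rcons x a)) 0.
  rewrite potential_eq0// pa0 mulr0 !add0r.
  by rewrite mulr_ge0 ?xi_ge0// divr_ge0// ltW.
have pa_gt0 : 0 < pr (nu i) (rcons x a).
  by rewrite lt_neqAle eq_sym pa0 pr_ge0.
have xa_gt0 := xi_gt0 pa_gt0.
have q_gt0 : 0 < xi_cond nu w x a / nu_cond nu i x a.
  by rewrite /xi_cond /nu_cond !divr_gt0.
have := ln_le_subr1 q_gt0.
rewrite -(ler_pM2l pa_gt0) potential_rcons// => le1.
have -> : pr (nu i) x / xi nu w x * xi nu w (rcons x a) =
    pr (nu i) (rcons x a) * (xi_cond nu w x a / nu_cond nu i x a).
  by rewrite /xi_cond /nu_cond; field; rewrite !gt_eqF.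
lra.
Qed.

(** A form of Gibbs' inequality: it yields the nonnegativity of the divergence, and before that the
    finiteness needed to subtract this sum. *)
Lemma esum_potential_le :
  (\esum_(a in [set: A]) (potential i (rcons x a))%:E <= (potential i x)%:E)%E.
Proof.
(* Adding the finite mass of [x] to both sides allows [potential_rcons_le] to be summed letter by
   letter. Its right side then sums to the potential at [x] plus that mass. *)
rewrite -(@leeD2rE _ (pr (nu i) x)%:E)//.
rewrite -[X in (_ + X <= _)%E](esum_pr_rcons cA) -esumD; last 2 first.
- by move=> a _; rewrite lee_fin potential_ge0.
- by move=> a _; rewrite lee_fin pr_ge0.
have l_ge0 : 0 <= ln (xi nu w x / (w i * pr (nu i) x)).
  by rewrite -(pmulr_rge0 _ p_gt0); exact: potential_ge0.
have c_ge0 : 0 <= pr (nu i) x / xi nu w x by rewrite divr_ge0// ltW.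
apply: (@le_trans _ _ (\esum_(a in [set: A])
    ((ln (xi nu w x / (w i * pr (nu i) x)))%:E * (pr (nu i) (rcons x a))%:E +
    (pr (nu i) x / xi nu w x)%:E * (xi nu w (rcons x a))%:E))%E).
  by apply: le_esum => a _; rewrite -!EFinM -!EFinD lee_fin potential_rcons_le.
rewrite esumD; last 2 first.
- by move=> a _; rewrite -EFinM lee_fin mulr_ge0 ?pr_ge0.
- by move=> a _; rewrite -EFinM lee_fin mulr_ge0 ?xi_ge0.
rewrite !esumZl//; last 2 first.
- by move=> a; rewrite lee_fin xi_ge0.
- by move=> a; rewrite lee_fin pr_ge0.
rewrite esum_pr_rcons// esum_xi_rcons -!EFinM -!EFinD lee_fin /potential.
by rewrite divfK ?gt_eqF// mulrC.
Qed.

(** The summands of the divergence have no fixed sign. Each is written as [f a - g a] with [f] and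
    [g] nonnegative and summable, where [f] carries the logarithm at [x] and [g] the potential at
    the extension. *)
Lemma dKL_potential_pos :
  (dKL nu w i x = (pr (nu i) x)^-1%:E *
    ((potential i x)%:E - \esum_(a in [set: A]) (potential i (rcons x a))%:E))%E.
Proof.
set N := pr (nu i) x; set l := ln (xi nu w x / (w i * N)).
have l_ge0 : 0 <= l by rewrite -(pmulr_rge0 _ p_gt0); exact: potential_ge0.
have NV_ge0 : 0 <= N^-1 by rewrite invr_ge0 ltW.
pose f a := ((l / N)%:E * (pr (nu i) (rcons x a))%:E)%E.
pose g a := (N^-1%:E * (potential i (rcons x a))%:E)%E.
have f0 a : (0 <= f a)%E by rewrite lee_fin mulr_ge0 ?pr_ge0 ?mulr_ge0.
have g0 a : (0 <= g a)%E by rewrite lee_fin mulr_ge0 ?potential_ge0.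
have Ef : (\esum_(a in [set: A]) f a = l%:E)%E.
  rewrite esumZl ?esum_pr_rcons ?mulr_ge0//.
    by rewrite -EFinM divfK// gt_eqF.
  by move=> a; rewrite lee_fin pr_ge0.
have Eg : (\esum_(a in [set: A]) g a =
    N^-1%:E * \esum_(a in [set: A]) (potential i (rcons x a))%:E)%E.
  by rewrite esumZl// => a; rewrite lee_fin potential_ge0.
have Sfin : (\esum_(a in [set: A]) (potential i (rcons x a))%:E)%E \is a fin_num.
  rewrite ge0_fin_numE; first by rewrite (le_lt_trans esum_potential_le)// ltry.
  by apply: esum_ge0 => a _; rewrite lee_fin potential_ge0.
rewrite muleBr// -EFinM -Eg.
rewrite [(N^-1 * _)%R](_ : _ = l); last first.
  by rewrite /potential -/N -/l mulKf// gt_eqF.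
(* [esumB] expresses the difference of the two sums through the positive and negative parts of
   [f - g], which is the shape of [xsum]. *)
rewrite -Ef -esumB//; last 2 first.
- rewrite /summable (eq_esum (b := f)); first by rewrite Ef ltry.
  by move=> a _; rewrite gee0_abs.
- rewrite /summable (eq_esum (b := g)); last by move=> a _; rewrite gee0_abs.
  by rewrite Eg -(fineK Sfin) -EFinM ltry.
have E a : (nu_cond nu i x a * ln (nu_cond nu i x a / xi_cond nu w x a))%:E =
    (f \- g)%E a.
  rewrite /= /f /g -!EFinM -EFinB; congr (_%:E).
  have [pa0|pa0] := eqVneq (pr (nu i) (rcons x a)) 0.
    by rewrite potential_eq0// /nu_cond pa0 !(mulr0, mul0r) subr0.
  have pa_gt0 : 0 < pr (nu i) (rcons x a).
    by rewrite lt_neqAle eq_sym pa0 pr_ge0.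
  have xa_gt0 := xi_gt0 pa_gt0.
  rewrite potential_rcons// -/N -/l -[in LHS](invf_div (xi_cond _ _ _ _)).
  rewrite lnV; last by rewrite posrE /xi_cond /nu_cond !divr_gt0.
  by rewrite {1}/nu_cond -/N; field; rewrite gt_eqF.
rewrite /dKL /xsum; congr (_ - _)%E; apply: eq_esum => a _.
  by rewrite E funeposE.
by rewrite E funenegE.
Qed.

End positive_word.

Lemma dKL_ge0 i x : (0 <= dKL nu w i x)%E.
Proof.
have [p0|p0] := eqVneq (pr (nu i) x) 0; first by rewrite dKL_eq0.
have p_gt0 : 0 < pr (nu i) x by rewrite lt_neqAle eq_sym p0 pr_ge0.
rewrite dKL_potential_pos// mule_ge0 ?lee_fin ?invr_ge0 ?pr_ge0//.
by rewrite sube_ge0 ?orbT//; exact: esum_potential_le.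
Qed.

(** The chain rule in additive form, valid at null words as well since every term is then zero. *)
Lemma dKL_potential i x :
  ((pr (nu i) x)%:E * dKL nu w i x +
   \esum_(a in [set: A]) (potential i (rcons x a))%:E = (potential i x)%:E)%E.
Proof.
have [p0|p0] := eqVneq (pr (nu i) x) 0.
  rewrite p0 mul0e add0e potential_eq0// esum1// => a _.
  by rewrite potential_eq0// pr_rcons_eq0.
have p_gt0 : 0 < pr (nu i) x by rewrite lt_neqAle eq_sym p0 pr_ge0.
rewrite dKL_potential_pos// muleA -EFinM divff// mul1e subeK//.
rewrite ge0_fin_numE.
  by rewrite (le_lt_trans (esum_potential_le p_gt0))// ltry.
by apply: esum_ge0 => a _; rewrite lee_fin potential_ge0.
Qed.


(* Telescoping over time and averaging over the prior *)
#[local] Hint Resolve wpr_ge0 xi_ge0 le_xi dKL_ge0 : core.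

Local Open Scope ereal_scope.

(** By [integral_prefix], this is the [nu i]-expectation of the divergence after [n] symbols. *)
Definition step_divergence i n : \bar R :=
  \esum_(x in words n) (pr (nu i) x)%:E * dKL nu w i x.

Lemma prdKL_ge0 i x : 0 <= (pr (nu i) x)%:E * dKL nu w i x.
Proof. by rewrite mule_ge0 ?dKL_ge0// lee_fin pr_ge0. Qed.

Lemma step_divergence_ge0 i n : 0 <= step_divergence i n.
Proof. by apply: esum_ge0 => x _; exact: prdKL_ge0. Qed.

(** Each induction step splits the words of length [n.+1] by their last letter and applies
    [dKL_potential] at every word of length [n]. *)
Lemma sum_step_divergence i n :
  \sum_(0 <= k < n) step_divergence i k +
  \esum_(x in words n) (potential i x)%:E = (- ln (w i))%:E.
Proof.
elim: n => [|n <-].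
  rewrite big_nil add0e (@esum_singleton _ _ _ [::]) ?potential_nil//.
  - by rewrite -potential_nil lee_fin potential_ge0.
  - by move=> x /size0nil.
rewrite big_nat_recr//= -addeA; congr (_ + _).
rewrite esum_words_rcons; last by move=> x; rewrite lee_fin potential_ge0.
rewrite -esumD.
- by apply: eq_esum => x _; rewrite dKL_potential.
- by move=> x _; exact: prdKL_ge0.
- by move=> x _; apply: esum_ge0 => a _; rewrite lee_fin potential_ge0.
Qed.

Lemma nneseries_step_divergence_le i :
  \sum_(n <oo) step_divergence i n <= (- ln (w i))%:E.
Proof.
apply: lime_le; first by apply: is_cvg_nneseries => n _ _; exact: step_divergence_ge0.
near=> n; rewrite -(sum_step_divergence i n) leeDl//.
by apply: esum_ge0 => x _; rewrite lee_fin potential_ge0.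
Unshelve. all: by end_near. Qed.

(* [ct nu w t om] is [info_gain (prefix om t)]. *)
Definition info_gain (x : seq A) : \bar R :=
  xsum (fun i => (post nu w i x)%:E * dKL nu w i x).

Lemma post_ge0 i x : (0 <= post nu w i x)%R.
Proof. by rewrite divr_ge0. Qed.

Lemma info_gainE x :
  info_gain x = \esum_(i in [set: I]) (post nu w i x)%:E * dKL nu w i x.
Proof.
by rewrite /info_gain ge0_xsumE// => i; rewrite mule_ge0// lee_fin post_ge0.
Qed.

Lemma info_gain_ge0 x : 0 <= info_gain x.
Proof.
by rewrite info_gainE esum_ge0// => i _; rewrite mule_ge0// lee_fin post_ge0.
Qed.

Lemma xi_info_gain x :
  (xi nu w x)%:E * info_gain x =
  \esum_(i in [set: I]) (w i)%:E * ((pr (nu i) x)%:E * dKL nu w i x).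
Proof.
rewrite info_gainE -esumZl//; last first.
  by move=> i; rewrite mule_ge0// lee_fin post_ge0.
apply: eq_esum => i _; rewrite !muleA -!EFinM; congr (_%:E * _).
(* Where [xi] vanishes the left side is zero, and [le_xi] forces [w i * pr (nu i) x] to vanish
   too. *)
rewrite /post; have [xi0|xi0] := eqVneq (xi nu w x) 0%R.
  by rewrite xi0 mul0r; apply/eqP; rewrite eq_le wpr_ge0/= -{1}xi0 le_xi.
by rewrite mulrC divfK.
Qed.

Lemma integral_info_gain_le i n :
  (w i)%:E * \int[nu i]_om info_gain (mkseq om n) <=
  \esum_(j in [set: I]) (w j)%:E * step_divergence j n.
Proof.
have Fge0 := info_gain_ge0.
rewrite integral_prefix// -esumZl//; last first.
  by move=> x; rewrite mule_ge0// lee_fin pr_ge0.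
rewrite (eq_esum (b := fun j => \esum_(x in words n)
    ((w j)%:E * ((pr (nu j) x)%:E * dKL nu w j x)))); last first.
  by move=> j _; rewrite esumZl// => x; exact: prdKL_ge0.
rewrite exchange_esum; last first.
  by move=> j x; rewrite mule_ge0 ?prdKL_ge0// lee_fin.
(* After the exchange, only the domination [w i * pr (nu i) x <= xi nu w x] is left to use at each
   word. *)
apply: le_esum => x _; rewrite -xi_info_gain muleCA muleC.
by rewrite lee_wpmul2r// -EFinM lee_fin.
Qed.

Lemma EntE : Ent w = \esum_(i in [set: I]) ((w i)%:E * (- ln (w i))%:E).
Proof.
rewrite /Ent ge0_xsumE.
  by apply: eq_esum => i _; rewrite -mulrN EFinM.
move=> i; rewrite -mulrN lee_fin mulr_ge0// oppr_ge0 ln_le0//.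
by have /andP[] := w01 i.
Qed.

Lemma measurable_info_gain n :
  measurable_fun [set: seqspace A] (fun om => info_gain (mkseq om n)).
Proof. by apply: (measurable_prefix cA) => x; exact: info_gain_ge0. Qed.

Lemma integral_sum_info_gain_le i :
  (w i)%:E * \int[nu i]_om (\sum_(n <oo) info_gain (mkseq om n)) <= Ent w.
Proof.
rewrite integral_nneseries//; last 2 first.
- exact: measurable_info_gain.
- by move=> n om _; exact: info_gain_ge0.
rewrite -nneseriesZl; last by move=> n _; apply: integral_ge0 => om _; exact: info_gain_ge0.
apply: (@le_trans _ _ (\sum_(n <oo)
    \esum_(j in [set: I]) (w j)%:E * step_divergence j n)).
  apply: lee_nneseries => n *; last exact: integral_info_gain_le.
  by rewrite mule_ge0 ?lee_fin//; apply: integral_ge0 => om _; exact: info_gain_ge0.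
have wD0 j n : 0 <= (w j)%:E * step_divergence j n.
  by rewrite mule_ge0 ?step_divergence_ge0// lee_fin.
rewrite nneseries_esumT; last by move=> n; exact: esum_ge0.
rewrite exchange_esum// EntE; apply: le_esum => j _.
rewrite esumZl//; last exact: step_divergence_ge0.
rewrite lee_wpmul2l ?lee_fin// -nneseries_esumT; last exact: step_divergence_ge0.
exact: nneseries_step_divergence_le.
Qed.

End mixture.

(** * Markov's inequality, stated for the complementary event *)

Lemma markov_probability_ge (R : realType) d (T : measurableType d)
    (P : probability T R) (f : T -> \bar R) (K : \bar R) (delta : R) :
  measurable_fun setT f -> (forall x, 0 <= f x)%E -> 0 < delta ->
  (\int[P]_x f x <= K)%E ->
  measurable [set x | (f x <= K * delta^-1%:E)%E] /\
  (P [set x | (f x <= K * delta^-1%:E)%E] >= (1 - delta)%:E)%E.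
Proof.
move=> mf f0 d0 fK.
have mE y : measurable [set x | (f x <= y)%E].
  by rewrite -[X in measurable X]setTI; exact: emeasurable_fun_infty_c.
have mB y : measurable [set x | (y < f x)%E].
  by rewrite -[X in measurable X]setTI; exact: emeasurable_fun_o_infty.
split=> //.
suff : (P [set x | (K * delta^-1%:E < f x)%E] <= delta%:E)%E.
  move=> PB; rewrite (_ : [set x | _] = ~` [set x | (K * delta^-1%:E < f x)%E]).
    by rewrite probability_setC// EFinB leeB.
  by apply/seteqP; split => x /=; [rewrite leNgt => /negP|move/negP; rewrite -leNgt].
have K0 : (0 <= K)%E by apply: le_trans fK; exact: integral_ge0.
have int_abs : (\int[P]_x `|f x| = \int[P]_x f x)%E.
  by apply: eq_integral => x _; rewrite gee0_abs.
(* For infinite [K] the threshold is infinite, so the exceptional set is empty. *)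
case: K K0 fK => [r| |//] r0 fK; last first.
  rewrite gt0_mulye ?lte_fin ?invr_gt0// (_ : [set x | _] = set0).
    by rewrite measure0 lee_fin ltW.
  by apply/seteqP; split => x //=; rewrite ltNge leey.
(* Markov's inequality is applied with a positive threshold, so [K = 0] is separate: [f] then
   vanishes almost everywhere, and the exceptional set lies in a null set. *)
move: r0; rewrite lee_fin le_eqVlt => /orP[/eqP r0|r_gt0].
  subst r.
  have : (\int[P]_x `|f x| = 0)%E.
    by apply/eqP; rewrite eq_le int_abs integral_ge0// andbT.
  move=> /(ae_eq_integral_abs P measurableT mf)[N [mN PN0 sN]].
  apply: (@le_trans _ _ (P N)); last by rewrite PN0 lee_fin ltW.
  apply: le_measure; rewrite ?inE// => x /=; rewrite mul0e => fx.
  by apply: sN => /= /(_ I) fx0; rewrite fx0 ltxx in fx.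
have a_gt0 : 0 < r / delta by rewrite divr_gt0.
have := @le_integral_comp_abse _ _ _ P _ measurableT f (r / delta) id
  (@measurable_id _ _ _) (fun r h => h) (fun x y _ _ h => h) mf a_gt0.
rewrite setTI int_abs => /le_trans /(_ fK) le1.
apply: (@le_trans _ _ (P [set x | ((r / delta)%:E <= `|f x|)%E])).
  apply: le_measure; rewrite ?inE//.
    rewrite -[X in measurable X]setTI; apply: emeasurable_fun_c_infty => //.
    exact: measurableT_comp.
  by move=> x /=; rewrite -EFinM gee0_abs// => /ltW.
move: le1; rewrite -lee_pdivlMl// -EFinM invf_div => /le_trans; apply.
by rewrite lee_fin divfK// gt_eqF.
Qed.

Theorem theorem7 (R : realType) (A : pointedType) (I : choiceType)
  (nu : I -> probability (seqspace A) R) (w : I -> R) (mu : I) (delta : R) :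
  countable [set: A] ->
  countable [set: I] ->
  injective nu ->
  (forall i, 0 < w i <= 1) ->
  (\esum_(i in [set: I]) (w i)%:E = 1)%E ->
  0 < delta < 1 ->
  let dhat := fun (t : nat) (om : nat -> A) =>
    (ct nu w t om * ((w mu * delta)^-1)%:E)%E in
  (\int[nu mu]_om (\sum_(1 <= t <oo) dhat t om)
     <= Ent w * ((delta * w mu ^+ 2)^-1)%:E)%E /\
  (exists E : set (seqspace A), measurable E /\
     (nu mu E >= (1 - delta)%:E)%E /\
     forall om, E om ->
       (\sum_(1 <= t <oo) dhat t om <= Ent w * ((delta ^+ 2 * w mu ^+ 2)^-1)%:E)%E).
Proof.
move=> cA _ _ w01 w1 /andP[d0 _] dhat.
have wmu0 : 0 < w mu by have /andP[] := w01 mu.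
pose X (om : seqspace A) := (\sum_(n <oo) info_gain nu w (mkseq om n))%E.
have g0 x : (0 <= info_gain nu w x)%E by exact: info_gain_ge0.
have X0 om : (0 <= X om)%E by apply: nneseries_ge0 => n *; exact: g0.
have mX : measurable_fun setT X.
  rewrite /X; apply: (ge0_emeasurable_sum (P := predT)) => [n om _ _|n _].
    exact: g0.
  exact: measurable_info_gain.
have kge0 : 0 <= (w mu * delta)^-1 by rewrite invr_ge0 mulr_ge0// ltW.
have dhatE om : (\sum_(1 <= t <oo) dhat t om = ((w mu * delta)^-1)%:E * X om)%E.
  (* Time [t] sees [t.-1] symbols, so the series from 1 becomes the series over all prefix lengths
     from 0. *)
  rewrite -nneseries_addn; last by move=> t; rewrite mule_ge0 ?g0.
  rewrite -nneseriesZl; last by move=> n _; exact: g0.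
  by apply: eq_eseriesr => n _; rewrite muleC /dhat /ct /prefix addn1.
have le1 : (\int[nu mu]_om (\sum_(1 <= t <oo) dhat t om)
     <= Ent w * ((delta * w mu ^+ 2)^-1)%:E)%E.
  under eq_integral do rewrite dhatE.
  rewrite ge0_integralZl//.
  (* One factor [(w mu)^-1] comes from the scaling in [dhat], the other from passing from [xi] to
     [nu mu]. *)
  rewrite (_ : (delta * w mu ^+ 2)^-1 = (w mu * delta)^-1 * (w mu)^-1); last first.
    by field; rewrite !gt_eqF.
  rewrite EFinM muleCA lee_wpmul2l ?lee_fin// muleC lee_pdivlMl//.
  exact: integral_sum_info_gain_le.
split=> //.
have mS : measurable_fun [set: seqspace A]
    (fun om => (\sum_(1 <= t <oo) dhat t om)%E).
  rewrite (_ : (fun _ => _) = fun om => ((w mu * delta)^-1)%:E * X om)%E.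
    exact: measurable_funeM.
  exact/funext.
have S0 (om : seqspace A) : (0 <= \sum_(1 <= t <oo) dhat t om)%E.
  by rewrite dhatE mule_ge0.
have [mE PE] := markov_probability_ge mS S0 d0 le1.
(* The event is the set where the series is at most the bound of the first claim divided by [delta],
   whence the square of [delta]. *)
eexists; split; [exact: mE|split; [exact: PE|]] => om /= /le_trans; apply.
rewrite -muleA -EFinM (_ : _ / _ = (delta ^+ 2 * w mu ^+ 2)^-1)//.
by field; rewrite !gt_eqF.
Qed.
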